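(* For the three-dimensional real Lie algebras $\mathfrak a_{3,4}$, $\mathfrak a_{3,5}$ and $\mathfrak a_{3,8}$, the set of Nijenhuis eigenbases (considered up to rescaling of the basis vectors) is described as follows. - For the algebra $\mathfrak a_{3,4}$ the set of Nijenhuis eigenbases is in one-to-one correspondence with triples of non-collinear points of $\mathbb RP^2$ lying on a given oval. - For the algebra $\mathfrak a_{3,5}$ the set of Nijenhuis eigenbases is in one-to-one correspondence with triples of non-collinear points of $\mathbb RP^2$. - For the algebra $\mathfrak a_{3,8}$ the set of Nijenhuis eigenbases is in one-to-one correspondence with triples of non-collinear points of $\mathbb RP^2$ lying on two given intersecting lines.
   Context: A Nijenhuis eigenbasis of a Lie algebra $\mathfrak g$ is a basis $\zeta_1,\dots,\zeta_n$ of $\mathfrak g$ such that, for all $i,j$, the bracket $[\zeta_i,\zeta_j]$ is a linear combination of $\zeta_i$ and $\zeta_j$. Two Nijenhuis eigenbases are considered equivalent if they are related by rescaling of vectors, $\zeta_i\to\lambda_i\zeta_i$ for some non-zero constants $\lambda_i$; ''Nijenhuis eigenbasis'' here means such an equivalence class. The Lie algebras are real, with basis $\eta_1,\eta_2,\eta_3$ and the following non-zero structural relations: $\mathfrak a_{3,4}$: $[\eta_1,\eta_2]=-\eta_3$, $[\eta_2,\eta_3]=\eta_1$, $[\eta_3,\eta_1]=\eta_2$; $\mathfrak a_{3,5}$: $[\eta_1,\eta_2]=\eta_2$, $[\eta_3,\eta_1]=-\eta_3$; $\mathfrak a_{3,8}$: $[\eta_1,\eta_2]=b\eta_2-\eta_3$,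 $[\eta_3,\eta_1]=\eta_2-b\eta_3$, where $b$ is an arbitrary real parameter. $\mathbb RP^2$ is the real projective plane; points are non-collinear if they do not lie on a common projective line. *)

(* Defs.v *)
From HB Require Import structures.
From mathcomp Require Import all_boot all_order all_algebra.
From mathcomp Require Import all_classical reals topology normedtype.
From mathcomp Require Import ring.

Set Implicit Arguments.
Unset Strict Implicit.
Unset Printing Implicit Defensive.

Import Order.TTheory GRing.Theory Num.Theory.
Import numFieldNormedType.Exports.

Local Open Scope classical_set_scope.
Local Open Scope ring_scope.

Section Eigenbases.
Variables (R : fieldType) (g : vectType R) (br : g -> g -> g).

Definition lie_bracket : Prop :=
  [/\ forall y, linear (br^~ y), forall x, linear (br x),
      forall x, br x x = 0
    & forall x y z, br x (br y z) + br y (br z x) + br z (br x y) = 0].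

Definition nijenhuis_eigenbasis n (z : n.-tuple g) : Prop :=
  basis_of {:g} z /\
  forall i j : 'I_n, br (tnth z i) (tnth z j) \in <<[:: tnth z i; tnth z j]>>%VS.

Definition rescaling_class n (z : n.-tuple g) : set (n.-tuple g) :=
  [set w | exists lam : 'I_n -> R,
     forall i, lam i != 0 /\ tnth w i = lam i *: tnth z i].

Definition eigenbasis_classes n : set (set (n.-tuple g)) :=
  [set rescaling_class z | z in @nijenhuis_eigenbasis n].

End Eigenbases.

Section ThreeDimensional.
Variable R : realType.
Notation V := 'rV[R]_3.

Definition eta (j : 'I_3) : V := delta_mx 0 j.
Definition eta1 : V := eta 0.
Definition eta2 : V := eta 1.
Definition eta3 : V := eta 2.

(* The alternating bilinear product on R^3 with [eta1,eta2] = c12,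
   [eta2,eta3] = c23 and [eta3,eta1] = c31. *)
Definition bracket3 (c12 c23 c31 u v : V) : V :=
  (u 0 0 * v 0 1 - u 0 1 * v 0 0) *: c12 +
  (u 0 1 * v 0 2 - u 0 2 * v 0 1) *: c23 +
  (u 0 2 * v 0 0 - u 0 0 * v 0 2) *: c31.

Definition a34 : V -> V -> V := bracket3 (- eta3) eta1 eta2.
Definition a35 : V -> V -> V := bracket3 eta2 0 (- eta3).
Definition a38 (b : R) : V -> V -> V :=
  bracket3 (b *: eta2 - eta3) 0 (eta2 - b *: eta3).

Lemma bracket3_eta c12 c23 c31 (br := bracket3 c12 c23 c31) :
  [/\ br eta1 eta2 = c12, br eta2 eta3 = c23 & br eta3 eta1 = c31].
Proof.
by split; rewrite /br /bracket3 !mxE /= ?(mulr0, mul0r, mulr1, subr0, subrr)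
  ?(scale0r, scale1r, addr0, add0r).
Qed.

Lemma bracket3_lie c12 c23 c31 (br := bracket3 c12 c23 c31) :
  br eta1 c23 + br eta2 c31 + br eta3 c12 = 0 -> lie_bracket br.
Proof.
move=> jac; have jacE (i : 'I_3) : (br eta1 c23 + br eta2 c31 + br eta3 c12) 0 i = 0.
  by rewrite jac mxE.
split=> [y a u v|x a u v|x|x y z]; apply/rowP => i; rewrite !mxE; [ring|ring|ring|].
move: (jacE i); rewrite !mxE /= => jacEi.
pose d := x 0 0 * (y 0 1 * z 0 2 - y 0 2 * z 0 1)
        + x 0 1 * (y 0 2 * z 0 0 - y 0 0 * z 0 2)
        + x 0 2 * (y 0 0 * z 0 1 - y 0 1 * z 0 0).
by rewrite -[RHS](mulr0 d) -[X in _ = _ * X]jacEi /d; ring.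
Qed.

Lemma a34_lie : lie_bracket a34.
Proof. by apply: bracket3_lie; apply/rowP => i; rewrite !mxE /=; ring. Qed.

Lemma a35_lie : lie_bracket a35.
Proof. by apply: bracket3_lie; apply/rowP => i; rewrite !mxE /=; ring. Qed.

Lemma a38_lie b : lie_bracket (a38 b).
Proof. by apply: bracket3_lie; apply/rowP => i; rewrite !mxE /=; ring. Qed.

(* Points and lines of RP^2 are the one- and two-dimensional subspaces of R^3;
   incidence is inclusion of subspaces. *)
Definition rp2 : set {vspace V} := [set p | \dim p = 1%N].
Definition rp2_lines : set {vspace V} := [set l | \dim l = 2%N].
Definition points_on (l : {vspace V}) : set {vspace V} :=
  [set p | rp2 p /\ (p <= l)%VS].

Definition collinear (p : 3.-tuple {vspace V}) : Prop :=
  exists2 l, rp2_lines l & forall i, points_on l (tnth p i).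

Definition noncollinear_triples (S : set {vspace V}) :
    set (3.-tuple {vspace V}) :=
  [set p | (forall i, S (tnth p i)) /\ ~ collinear p].

(* An oval of the real projective plane: a nonempty closed set of points with
   no three distinct points on a line and exactly one tangent at each point.
   Closedness in the quotient topology of RP^2 is expressed on the cone over
   the set. *)
Definition oval (O : set {vspace V}) : Prop :=
  [/\ O `<=` rp2, O !=set0,
      closed [set v : V | v = 0 \/ O <[v]>%VS],
      forall p : 3.-tuple {vspace V},
        uniq p -> (forall i, O (tnth p i)) -> ~ collinear p
    & forall p, O p -> exists! l, rp2_lines l /\ O `&` points_on l = [set p] ].

(* The i-th vector zeta^i of the basis dual to z is the linear form [coord z i].
   Its kernel is spanned by the z_j with j != i.  In the basis dual to
   eta1, eta2, eta3 its coordinates are the values zeta^i(eta_j), which identifies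
   the projective plane of g^* with RP^2. *)
Definition dual_point (z : 3.-tuple V) (i : 'I_3) : {vspace V} :=
  <[(\row_j coord z i (eta j))%R]>%VS.

Definition dual_triple (z : 3.-tuple V) : 3.-tuple {vspace V} :=
  [tuple dual_point z i | i < 3].

(* A bare bijection would only compare cardinalities, so the correspondence is
   required to be the geometric one, induced by the dual basis. *)
Definition eigenbases_correspond (br : V -> V -> V) (S : set {vspace V}) : Prop :=
  exists f : set (3.-tuple V) -> 3.-tuple {vspace V},
    set_bij (@eigenbasis_classes R V br 3) (noncollinear_triples S) f /\
    forall z, nijenhuis_eigenbasis br z -> f (rescaling_class z) = dual_triple z.

End ThreeDimensional.

(* Main.v *)
(* If x is the basis dual to z, then z_i × z_j is a nonzero multiple of x_k for
   {i,j,k} = {1,2,3}.  Every bracket on R^3 has the form [u,v] = tau (u × v) with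
   tau linear, so z_k does not occur in [z_i,z_j] exactly when x_k is a zero of
   the quadratic form q(x) = tau(x).x.  Hence Nijenhuis eigenbases correspond to
   non-collinear triples on the conic q = 0, where q is x^2 + y^2 - z^2 for a34,
   0 for a35 and y^2 - z^2 for a38. *)
Require Import Defs.
From mathcomp Require Import all_boot all_order all_algebra.
From mathcomp Require Import all_classical reals topology normedtype.
From mathcomp Require Import ring lra.

Set Implicit Arguments.
Unset Strict Implicit.
Unset Printing Implicit Defensive.

Import Order.TTheory GRing.Theory Num.Theory.
Import numFieldNormedType.Exports.

Local Open Scope classical_set_scope.
Local Open Scope ring_scope.

Section ConicOfEigenbases.
Variable R : realType.
Notation V := 'rV[R]_3.
Implicit Types (u v w a : V) (z x y : 'I_3 -> V).

(** * Coordinates and indices in dimension three *)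

Lemma sum_ord3 (W : zmodType) (F : 'I_3 -> W) : \sum_i F i = F 0 + F 1 + F 2.
Proof.
rewrite !big_ord_recl big_ord0 addr0 addrA.
by congr (F _ + F _ + F _); apply: val_inj.
Qed.

Lemma row3P (u v : V) :
  u 0 0 = v 0 0 -> u 0 1 = v 0 1 -> u 0 2 = v 0 2 -> u = v.
Proof.
move=> h0 h1 h2; apply/rowP; case=> -[|[|[|//]]] lti.
- by rewrite (_ : Ordinal lti = 0) //; apply: val_inj.
- by rewrite (_ : Ordinal lti = 1) //; apply: val_inj.
- by rewrite (_ : Ordinal lti = 2) //; apply: val_inj.
Qed.

Lemma ord3_third (i j : 'I_3) : i != j -> exists2 k, k != i & k != j.
Proof.
case: i j => -[|[|[|//]]] lti [[|[|[|//]]] ltj] // _;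
  by [exists 0 | exists 1 | exists 2].
Qed.

Lemma ord3_only_third (i j k l : 'I_3) :
  i != j -> k != i -> k != j -> l != i -> l != j -> l = k.
Proof.
case: i j k l => -[|[|[|//]]] lti [[|[|[|//]]] ltj] [[|[|[|//]]] ltk]
  [[|[|[|//]]] ltl] // *; exact: val_inj.
Qed.

(** * Dot product, cross product and dual bases *)

Definition dot (u v : V) : R :=
  u 0 0 * v 0 0 + u 0 1 * v 0 1 + u 0 2 * v 0 2.

Definition cross (u v : V) : V := bracket3 (eta3 R) (eta1 R) (eta2 R) u v.

(** Linear forms are represented by row vectors through [dot]. The relation is symmetric and already
    forces both families to be bases. *)
Definition dual_families (z x : 'I_3 -> V) : Prop :=
  forall i j, dot (z i) (x j) = (i == j)%:R.

Lemma dotC u v : dot u v = dot v u.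
Proof. rewrite /dot; ring. Qed.

Lemma dotDl u v w : dot (u + v) w = dot u w + dot v w.
Proof. rewrite /dot !mxE; ring. Qed.

Lemma dotZl (k : R) u v : dot (k *: u) v = k * dot u v.
Proof. rewrite /dot !mxE; ring. Qed.

Lemma dot0l v : dot 0 v = 0.
Proof. rewrite /dot !mxE; ring. Qed.

Lemma dot_suml I (r : seq I) (F : I -> V) v :
  dot (\sum_(i <- r) F i) v = \sum_(i <- r) dot (F i) v.
Proof.
elim: r => [|i r IH]; first by rewrite !big_nil dot0l.
by rewrite !big_cons dotDl IH.
Qed.

Lemma cross_dotl u v : dot (cross u v) u = 0.
Proof. rewrite /cross /bracket3 /dot !mxE /=; ring. Qed.

Lemma cross_dotr u v : dot (cross u v) v = 0.
Proof. rewrite /cross /bracket3 /dot !mxE /=; ring. Qed.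

Lemma binet_cauchy u v w a :
  dot (cross u v) (cross w a) = dot u w * dot v a - dot u a * dot v w.
Proof. rewrite /cross /bracket3 /dot !mxE /=; ring. Qed.

Lemma dot_mulmx n m (Z : 'M[R]_(n, 3)) (X : 'M[R]_(m, 3)) i j :
  (Z *m X^T) i j = dot (row i Z) (row j X).
Proof. by rewrite mxE sum_ord3 /dot !mxE. Qed.

Lemma dual_families_matrixP (z x : 'I_3 -> V) :
  dual_families z x <-> (\matrix_i z i) *m (\matrix_i x i)^T = 1%:M.
Proof.
split=> [zx|zx i j].
  by apply/matrixP => i j; rewrite dot_mulmx !rowK zx !mxE.
have /matrixP/(_ i j) := zx.
by rewrite dot_mulmx !rowK !mxE.
Qed.

Lemma dual_families_sym z x : dual_families z x -> dual_families x z.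
Proof. by move=> zx i j; rewrite dotC zx eq_sym. Qed.

Lemma dual_families_decomp z x v :
  dual_families z x -> v = \sum_i dot v (x i) *: z i.
Proof.
(* A one-sided inverse of a square matrix is two-sided; v = v X^T Z is then the wanted expansion. *)
move=> /dual_families_matrixP/mulmx1C h.
rewrite -{1}[v]mulmx1 -h mulmxA mulmx_sum_row; apply: eq_bigr => i _.
rewrite rowK mxE sum_ord3 /dot; congr (_ *: _); by rewrite !mxE.
Qed.

Lemma dual_families_full z x (U : {vspace V}) :
  dual_families z x -> (forall i, z i \in U) -> \dim U = 3%N.
Proof.
move=> zx zU; suff -> : U = fullv by rewrite dimvf /dim /= mul1n.
apply/vspaceP => v; rewrite memvf (dual_families_decomp v zx).
by apply: memv_suml => i _; rewrite memvZ.
Qed.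

Lemma dual_families_neq0 z x i : dual_families z x -> x i != 0.
Proof.
move=> /dual_families_sym/(_ i i); rewrite eqxx => h; apply/eqP => x0.
by move: h; rewrite x0 dot0l => /esym/eqP; rewrite oner_eq0.
Qed.

(** Pairing a linear relation between the z_i with x_i isolates its i-th coefficient; three free
    vectors fill dimension three. *)
Lemma dual_families_basis (z : 3.-tuple V) x :
  dual_families (tnth z) x -> basis_of {:V} z.
Proof.
move=> zx; rewrite basisEfree subvf dimvf /dim /= size_tuple mul1n leqnn !andbT.
apply/freeP => k k0 i.
have : dot (\sum_(i < 3) k i *: z`_i) (x i) = 0 by rewrite k0 dot0l.
rewrite dot_suml (bigD1 i) //= big1 ?addr0.
  by rewrite dotZl -tnth_nth zx eqxx mulr1.
by move=> j ji; rewrite dotZl -tnth_nth zx (negbTE ji) mulr0.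
Qed.

(** The spanning vector of [dual_point z i], kept apart from the point because duality depends on
    its scale. *)
Definition dual_basis (z : 3.-tuple V) (i : 'I_3) : V :=
  \row_j coord z i (eta R j).

Lemma dot_dual_basis (z : 3.-tuple V) v i :
  dot v (dual_basis z i) = coord z i v.
Proof.
rewrite {2}[v]row_sum_delta linear_sum sum_ord3 /dot !mxE.
by rewrite !linearZ /=.
Qed.

Lemma basis_dual_families (z : 3.-tuple V) :
  basis_of {:V} z -> dual_families (tnth z) (dual_basis z).
Proof.
move=> /basis_free zf i j.
by rewrite dot_dual_basis (tnth_nth 0) coord_free.
Qed.

Lemma dual_families_unique z x y :
  dual_families z x -> dual_families z y -> x =1 y.
Proof.
move=> zx zy i; rewrite (dual_families_decomp (x i) (dual_families_sym zy)).
rewrite (bigD1 i) //= dotC zx eqxx scale1r big1 ?addr0 //.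
by move=> j ji; rewrite dotC zx (negbTE ji) scale0r.
Qed.

Lemma dual_familiesZ (c : 'I_3 -> R) z x : (forall i, c i != 0) ->
  dual_families z x ->
  dual_families (fun i => c i *: z i) (fun i => (c i)^-1 *: x i).
Proof.
move=> c0 zx i j; rewrite dotZl dotC dotZl dotC zx.
by case: eqVneq => [->|_]; rewrite ?mulr0 // mulr1 mulfV.
Qed.

(** * Points and lines of the projective plane *)

Lemma vline_eqP (u v : V) : u != 0 -> v != 0 -> <[u]>%VS = <[v]>%VS ->
  exists2 c, c != 0 & v = c *: u.
Proof.
move=> u0 v0 uv; have /vlineP[c vE] : v \in <[u]>%VS by rewrite uv memv_line.
by exists c => //; apply: contraNneq v0 => c0; rewrite vE c0 scale0r.
Qed.

Lemma vlineZ (c : R) (u : V) : c != 0 -> <[c *: u]>%VS = <[u]>%VS.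
Proof.
move=> c0; apply/eqP; rewrite eqEsubv -!memvE memvZ ?memv_line //=.
by rewrite -{1}[u](scalerK c0) memvZ ?memv_line.
Qed.

Lemma rp2_vline (u : V) : u != 0 -> rp2 <[u]>%VS.
Proof. by move=> u0; rewrite /rp2 /= dim_vline u0. Qed.

Lemma rp2P (p : {vspace V}) : rp2 p -> exists2 u, u != 0 & p = <[u]>%VS.
Proof.
rewrite /rp2 /= => p1; exists (vpick p).
  by rewrite vpick0 -dimv_eq0 p1.
apply/esym/eqP; rewrite eqEdim -memvE memv_pick p1 dim_vline vpick0 -dimv_eq0.
by rewrite p1.
Qed.

(** Encoded as the kernel of v |-> v a^T, so that rank-nullity gives its dimension. *)
Definition perp (a : V) : {vspace V} := lker (linfun (mulmxr a^T)).

Lemma mem_perp a v : (v \in perp a) = (dot v a == 0).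
Proof.
rewrite memv_ker lfunE /=; apply/eqP/eqP => [h|h].
  by move/matrixP/(_ 0 0): h; rewrite dot_mulmx !row_id mxE.
by apply/matrixP => i j; rewrite !ord1 dot_mulmx !row_id h mxE.
Qed.

Lemma dot_self_eq0 a : dot a a = 0 -> a = 0.
Proof.
rewrite /dot => h.
have [h0 h1 h2] : [/\ a 0 0 ^+ 2 = 0, a 0 1 ^+ 2 = 0 & a 0 2 ^+ 2 = 0].
  by split; nra.
apply: row3P; rewrite mxE; apply/eqP; rewrite -sqrf_eq0; exact/eqP.
Qed.

Lemma perp_line a : a != 0 -> rp2_lines (perp a).
Proof.
move=> a0; rewrite /rp2_lines /=.
have := limg_ker_dim (linfun (mulmxr a^T) : 'Hom(V, _)) fullv.
rewrite capfv -/(perp a) [\dim fullv]dimvf /dim /= mul1n => dimE.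
set I := (_ @: _)%VS in dimE.
have : (\dim I <= 1)%N.
  by apply: leq_trans (dimvS (subvf I)) _; rewrite dimvf /dim.
(* If the image were zero, a would be orthogonal to itself, hence zero. *)
have : (0 < \dim I)%N.
  rewrite lt0n; apply/eqP => I0; move: dimE; rewrite I0 addn0 => d3.
  have : a \in perp a.
    suff -> : perp a = fullv by rewrite memvf.
    by apply/eqP; rewrite eqEdim subvf dimvf /dim /= mul1n d3.
  by rewrite mem_perp => /eqP/dot_self_eq0 a00; rewrite a00 eqxx in a0.
by case: (\dim I) dimE => [|[|]] //; rewrite addn1 => -[].
Qed.

(** Both sides say that the matrix X with rows x_i is invertible. If it is singular, a nonzero a
    with a X^T = 0 gives the line [perp a] through the three points; otherwise the rows of the
    inverse of X^T are dual to x. *)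
Lemma noncollinearP (x : 'I_3 -> V) (p : 3.-tuple {vspace V}) :
  (forall i, x i != 0) -> (forall i, tnth p i = <[x i]>%VS) ->
  ~ collinear p <-> exists z, dual_families z x.
Proof.
move=> x0 pE; split=> [ncol|[z zx] [l l2 lp]]; last first.
  have : \dim l = 3%N.
    apply: dual_families_full (dual_families_sym zx) _ => i.
    by have [_] := lp i; rewrite pE memvE.
  by rewrite l2.
pose X := \matrix_i x i.
case: (boolP (\det X^T == 0)) => [/det0P[a a0 aX]|detX].
  case: ncol; exists (perp a); first exact: perp_line.
  have ax i : dot a (x i) = 0.
    move/matrixP/(_ 0 i): aX;
    by rewrite dot_mulmx row_id rowK mxE.
  move=> i; split; rewrite pE; first exact: rp2_vline.
  by rewrite -memvE mem_perp dotC ax.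
have Xu : X^T \in unitmx by rewrite unitmxE unitfE.
exists (fun i => row i (invmx X^T)); apply/dual_families_matrixP.
rewrite (_ : \matrix_i _ = invmx X^T) ?mulVmx //.
by apply/row_matrixP => i; rewrite rowK.
Qed.

(** * The Nijenhuis condition as a quadratic equation on the dual basis *)

(** This is q(u) = tau(u).u, where tau sends eta3, eta1, eta2 to c12, c23, c31, because eta3 = eta1
    × eta2 and cyclically. *)
Definition bracket_form (c12 c23 c31 u : V) : R :=
  dot (u 0 2 *: c12 + u 0 0 *: c23 + u 0 1 *: c31) u.

(** The product z_i × z_j is orthogonal to z_i and z_j, so in the basis x only its x_k coordinate
    survives. *)
Lemma cross_dual_families z x i j k : dual_families z x ->
  i != j -> k != i -> k != j ->
  exists2 c, c != 0 & cross (z i) (z j) = c *: x k.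
Proof.
move=> zx ij ki kj; set w := cross _ _.
have wE : w = dot w (z k) *: x k.
  rewrite {1}[w](dual_families_decomp _ (dual_families_sym zx)).
  rewrite (bigD1 k) //= big1 ?addr0 // => l lk.
  have [->|li] := eqVneq l i; first by rewrite cross_dotl scale0r.
  have [->|lj] := eqVneq l j; first by rewrite cross_dotr scale0r.
  by rewrite (ord3_only_third ij ki kj li lj) eqxx in lk.
exists (dot w (z k)) => //; apply/eqP => c0.
(* Pairing with x_i × x_j gives 1, so z_i × z_j cannot vanish. *)
have := binet_cauchy (z i) (z j) (x i) (x j).
rewrite -/w wE c0 scale0r dot0l !zx !eqxx (negbTE ij) mul0r subr0 mulr1.
by move/eqP; rewrite eq_sym oner_eq0.
Qed.

Lemma bracket3_dual_families c12 c23 c31 z x i j k : dual_families z x ->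
  i != j -> k != i -> k != j ->
  exists2 c, c != 0 &
    dot (bracket3 c12 c23 c31 (z i) (z j)) (x k) =
    c * bracket_form c12 c23 c31 (x k).
Proof.
move=> zx ij ki kj.
have [c c0 cE] := cross_dual_families zx ij ki kj; exists c => //.
rewrite /bracket_form -dotZl !scalerDr !scalerA.
(* Once c x_k is replaced by z_i × z_j, the claim is the polynomial identity [u,v] = tau(u × v)
   paired with x_k. *)
have cx l : c * x k 0 l = cross (z i) (z j) 0 l by rewrite cE mxE.
rewrite !cx /cross /bracket3 !mxE /= /dot !mxE; ring.
Qed.

Lemma ord3_others (k : 'I_3) :
  exists i j : 'I_3, [/\ i != j, k != i & k != j].
Proof.
by case: k => -[|[|[|//]]] ltk;
  [exists 1, 2 | exists 2, 0 | exists 0, 1].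
Qed.

(** The z_k coefficient of [z_i,z_j] is its pairing with x_k, and each k is the third index of some
    pair i, j. *)
Lemma nijenhuis_dual_basisP c12 c23 c31 (z : 3.-tuple V) x :
  dual_families (tnth z) x ->
  nijenhuis_eigenbasis (bracket3 c12 c23 c31) z <->
  forall k, bracket_form c12 c23 c31 (x k) = 0.
Proof.
move=> zx; split=> [[_ br] k|q0].
  have [i [j [ij ki kj]]] := ord3_others k.
  have [c c0 cE] := bracket3_dual_families c12 c23 c31 zx ij ki kj.
  apply/eqP; rewrite -[_ == 0](mulrI_eq0 _ (mulfI c0)) -cE.
  have := br i j; rewrite span_cons span_seq1.
  move=> /memv_addP[_ /vlineP[a ->] [_ /vlineP[d ->] ->]].
  by rewrite dotDl !dotZl !zx [i == k]eq_sym (negbTE ki)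
    [j == k]eq_sym (negbTE kj) !mulr0 addr0.
split=> [|i j]; first exact: dual_families_basis zx.
have [->|ij] := eqVneq i j.
  have -> u : bracket3 c12 c23 c31 u u = 0.
    by apply/rowP => l; rewrite !mxE; ring.
  exact: mem0v.
have [k ki kj] := ord3_third ij.
have [c c0 cE] := bracket3_dual_families c12 c23 c31 zx ij ki kj.
rewrite (dual_families_decomp (bracket3 _ _ _ _ _) zx).
apply: memv_suml => l _.
have [->|li] := eqVneq l i; first by rewrite memvZ ?memv_span ?mem_head.
have [->|lj] := eqVneq l j; first
  by rewrite memvZ ?memv_span ?in_cons ?eqxx ?orbT.
by rewrite (ord3_only_third ij ki kj li lj) cE q0 mulr0 scale0r mem0v.
Qed.

(** * Rescaling classes and the correspondence for a general bracket *)

Lemma rescaling_class_eq (z w : 3.-tuple V) (lam : 'I_3 -> R) :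
  (forall i, lam i != 0) -> (forall i, tnth w i = lam i *: tnth z i) ->
  rescaling_class z = rescaling_class w.
Proof.
move=> lam0 wz; apply/seteqP; split=> t [mu tmu].
  exists (fun i => mu i / lam i) => i; have [mu0 ->] := tmu i.
  by rewrite wz scalerA divfK // mulf_neq0 ?invr_eq0.
exists (fun i => mu i * lam i) => i; have [mu0 ->] := tmu i.
by rewrite wz scalerA mulf_neq0.
Qed.

Lemma tnth_dual_triple (z : 3.-tuple V) i :
  tnth (dual_triple z) i = <[dual_basis z i]>%VS.
Proof. by rewrite tnth_mktuple. Qed.

(** One direction makes the correspondence well defined on classes, the other makes it injective.
    Scaling z_i by a factor scales its dual vector by the inverse factor, which leaves the spanned
    point unchanged. *)
Lemma dual_triple_eqP (z w : 3.-tuple V) :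
  basis_of {:V} z -> basis_of {:V} w ->
  rescaling_class z = rescaling_class w <-> dual_triple z = dual_triple w.
Proof.
move=> /basis_dual_families zx /basis_dual_families wy; split=> [zw|zw].
  have : rescaling_class w w.
    by exists (fun=> 1) => i; rewrite oner_eq0 scale1r.
  rewrite -zw => -[lam wE]; apply: eq_from_tnth => i; rewrite !tnth_dual_triple.
  have lam0 j : lam j != 0 by case: (wE j).
  have := dual_familiesZ lam0 zx => zx'.
  have {}zx' : dual_families (tnth w) (fun i => (lam i)^-1 *: dual_basis z i).
    by move=> j k; have [_ ->] := wE j; exact: zx'.
  by rewrite -(dual_families_unique zx' wy) vlineZ // invr_eq0.
have /choice[c cP] i : exists c, c != 0 /\ dual_basis w i = c *: dual_basis z i.
  have [|||c c0 cE] := @vline_eqP (dual_basis z i) (dual_basis w i).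
  - exact: dual_families_neq0 zx.
  - exact: dual_families_neq0 wy.
  - by rewrite -!tnth_dual_triple zw.
  by exists c.
have c0 i : (c i)^-1 != 0 by rewrite invr_eq0; case: (cP i).
apply: (rescaling_class_eq c0) => i.
(* Both w and the rescaled z are dual to the dual basis of w, so they coincide. *)
apply: (dual_families_unique (y := fun i => (c i)^-1 *: tnth z i)
  (dual_families_sym wy)).
have := dual_familiesZ c0 zx => /dual_families_sym zx' j k.
by rewrite -zx'; have [_ ->] := cP j; rewrite invrK.
Qed.

(** Reduces each algebra to recognizing S as the zero locus of its quadratic form. *)
Lemma eigenbases_correspond_quadric c12 c23 c31 (S : set {vspace V}) :
  S `<=` @rp2 R ->
  (forall u, u != 0 -> S <[u]>%VS <-> bracket_form c12 c23 c31 u = 0) ->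
  eigenbases_correspond (bracket3 c12 c23 c31) S.
Proof.
set br := bracket3 c12 c23 c31 => S_rp2 SP.
(* The map sends a class to the dual triple of a chosen representative. The default zero tuple is
   never taken on a class of eigenbases. *)
pose rep C := xget [tuple 0 | i < 3]
  [set z : 3.-tuple V | nijenhuis_eigenbasis br z /\ rescaling_class z = C].
have fE (z : 3.-tuple V) : nijenhuis_eigenbasis br z ->
    dual_triple (rep (rescaling_class z)) = dual_triple z.
  move=> zN; have [wN wz] : [set w | nijenhuis_eigenbasis br w /\
      rescaling_class w = rescaling_class z] (rep (rescaling_class z)).
    by apply: xgetPex; exists z.
  by apply/dual_triple_eqP; [case: wN | case: zN |].
exists (fun C => dual_triple (rep C)); split=> //; split.
- move=> _ [z zN <-] /=; rewrite fE //.
  have zx := basis_dual_families zN.1.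
  have x0 i := dual_families_neq0 i zx.
  split=> [i|]; last first.
    by apply/(noncollinearP x0 (tnth_dual_triple z)); exists (tnth z).
  rewrite tnth_dual_triple; apply/SP => //.
  exact: (nijenhuis_dual_basisP c12 c23 c31 zx).1.
- move=> C D; rewrite !inE => -[z zN <-] [w wN <-]; rewrite !fE //.
  by move/dual_triple_eqP; apply; [case: zN | case: wN].
(* Surjectivity: vectors spanning the three points have a dual family z, and uniqueness of duals
   identifies the dual triple of z with p. *)
- move=> p [pS ncol].
  have /choice[x xP] i : exists u, u != 0 /\ tnth p i = <[u]>%VS.
    by have [u u0 uE] := rp2P (S_rp2 _ (pS i)); exists u.
  have x0 i : x i != 0 by case: (xP i).
  have [z zx] := (noncollinearP x0 (fun i => (xP i).2)).1 ncol.
  have zx' : dual_families (tnth [tuple z i | i < 3]) x.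
    by move=> i j; rewrite tnth_mktuple.
  have zN : nijenhuis_eigenbasis br [tuple z i | i < 3].
    apply/(nijenhuis_dual_basisP _ _ _ zx') => k; apply/SP => //.
    by case: (xP k) => _ <-.
  exists (rescaling_class [tuple z i | i < 3]); first
    by exists [tuple z i | i < 3].
  rewrite fE //; apply: eq_from_tnth => i; rewrite tnth_dual_triple.
  have zy := basis_dual_families zN.1.
  by rewrite (dual_families_unique zy zx'); case: (xP i).
Qed.

(** * The algebras a35 and a38 *)

Lemma points_on_perp u a :
  u != 0 -> points_on (perp a) <[u]>%VS <-> dot u a = 0.
Proof.
move=> u0; split=> [[_]|ua]; rewrite -?memvE ?mem_perp; first by move/eqP.
by split; [exact: rp2_vline | rewrite -memvE mem_perp ua].
Qed.

(** Here q(u) = u3 u2 - u2 u3 vanishes identically. *)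
Lemma a35_correspond : eigenbases_correspond (@a35 R) (@rp2 R).
Proof.
apply: eigenbases_correspond_quadric => // u u0; split=> _;
  last exact: rp2_vline.
by rewrite /bracket_form /dot !mxE /=; ring.
Qed.

(** The terms in b cancel, leaving (u2 - u3)(u2 + u3); the two lines are the same for every b. *)
Lemma a38_correspond b : eigenbases_correspond (@a38 R b)
  (points_on (perp (eta2 R - eta3 R)) `|` points_on (perp (eta2 R + eta3 R))).
Proof.
apply: eigenbases_correspond_quadric => [p [] []//|u u0].
have -> : bracket_form (b *: eta2 R - eta3 R) 0 (eta2 R - b *: eta3 R) u =
    dot u (eta2 R - eta3 R) * dot u (eta2 R + eta3 R).
  by rewrite /bracket_form /dot !mxE /=; ring.
split=> [[] /(points_on_perp _ u0) ->|/eqP]; rewrite ?mul0r ?mulr0 //.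
by rewrite mulf_eq0 => /orP[] /eqP h; [left | right]; apply/points_on_perp.
Qed.

(** Two lines of a projective plane always meet, so intersecting lines means distinct lines. The
    vector eta2 + eta3 lies on the first line but not on the second. *)
Lemma a38_lines_neq :
  [/\ eta2 R - eta3 R != 0, eta2 R + eta3 R != 0
    & perp (eta2 R - eta3 R) <> perp (eta2 R + eta3 R)].
Proof.
split.
- by apply/eqP => /rowP/(_ 1)/eqP; rewrite !mxE /= subr0 oner_eq0.
- by apply/eqP => /rowP/(_ 1)/eqP; rewrite !mxE /= addr0 oner_eq0.
move=> /vspaceP/(_ (eta2 R + eta3 R)); rewrite !mem_perp.
have -> : dot (eta2 R + eta3 R) (eta2 R - eta3 R) = 0.
  by rewrite /dot !mxE /=; ring.
have -> : dot (eta2 R + eta3 R) (eta2 R + eta3 R) = 2.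
  by rewrite /dot !mxE /=; ring.
by rewrite eqxx pnatr_eq0.
Qed.

(** * The algebra a34 and its conic, shown to be an oval *)

(** The symmetric bilinear form of signature (2,1) whose quadratic form is q for a34. *)
Definition lorentz u v : R :=
  u 0 0 * v 0 0 + u 0 1 * v 0 1 - u 0 2 * v 0 2.

Definition light_cone : set {vspace V} :=
  [set p | exists2 u, u != 0 & p = <[u]>%VS /\ lorentz u u = 0].

Lemma lorentzC u v : lorentz u v = lorentz v u.
Proof. by rewrite /lorentz; ring. Qed.

Lemma lorentzZr k u v : lorentz u (k *: v) = k * lorentz u v.
Proof. by rewrite /lorentz !mxE; ring. Qed.

Lemma lorentzDr u v w : lorentz u (v + w) = lorentz u v + lorentz u w.
Proof. by rewrite /lorentz !mxE; ring. Qed.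

Lemma light_coneP u : u != 0 -> light_cone <[u]>%VS <-> lorentz u u = 0.
Proof.
move=> u0; split=> [[v v0 [uv vv]]|uu]; last by exists u.
have [k _ ->] := vline_eqP v0 u0 (esym uv).
by rewrite lorentzZr lorentzC lorentzZr vv !mulr0.
Qed.

Lemma light_cone_rp2 : light_cone `<=` @rp2 R.
Proof. by move=> _ [u u0 [-> _]]; exact: rp2_vline. Qed.

Lemma a34_correspond : eigenbases_correspond (@a34 R) light_cone.
Proof.
apply: eigenbases_correspond_quadric light_cone_rp2 _ => u u0.
have -> : bracket_form (- eta3 R) (eta1 R) (eta2 R) u = lorentz u u.
  by rewrite /bracket_form /dot /lorentz !mxE /=; ring.
exact: light_coneP.
Qed.

(** A nonzero null vector has nonzero last coordinate, so u and v can be scaled to agree there.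
    Their difference is null with last coordinate zero, hence zero. *)
Lemma lorentz_null_orthogonal u v : u != 0 -> v != 0 ->
  lorentz u u = 0 -> lorentz v v = 0 -> lorentz u v = 0 ->
  <[u]>%VS = <[v]>%VS.
Proof.
have time_neq0 w : w != 0 -> lorentz w w = 0 -> w 0 2 != 0.
  move=> w0 ww; apply: contraNneq w0 => w2; apply/eqP/dot_self_eq0.
  by move: ww; rewrite /lorentz /dot w2 mulr0 subr0 addr0.
move=> u0 v0 uu vv uv.
have u2 := time_neq0 _ u0 uu; have v2 := time_neq0 _ v0 vv.
have : u 0 2 *: v = v 0 2 *: u.
  apply/eqP; rewrite -subr_eq0; apply/eqP/dot_self_eq0.
  (* This is the Lorentz square of [u 0 2 *: v - v 0 2 *: u], equal to its Euclidean square because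
     the last coordinate vanishes. *)
  have : u 0 2 ^+ 2 * lorentz v v + v 0 2 ^+ 2 * lorentz u u
      - 2 * u 0 2 * v 0 2 * lorentz u v = 0 by rewrite uu vv uv; ring.
  by move=> <-; rewrite /dot /lorentz !mxE; ring.
by move=> uvE; rewrite -(vlineZ u v2) -uvE vlineZ.
Qed.

(** With the origin included, the cone is the whole zero set of a continuous function. *)
Lemma light_cone_closed :
  closed [set v : V | v = 0 \/ light_cone <[v]>%VS].
Proof.
have -> : [set v : V | v = 0 \/ light_cone <[v]>%VS] =
    (fun v => lorentz v v) @^-1` [set x | x = 0].
  apply/seteqP; split=> v /=.
    case=> [->|]; first by rewrite /lorentz !mxE; ring.
    have [->|v0] := eqVneq v 0; first by rewrite /lorentz !mxE => _; ring.
    by move/(light_coneP v0).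
  by have [->|v0] := eqVneq v 0; [left | right; apply/light_coneP].
apply: preimage_closed; last exact: closed_eq.
move=> v _.
have co (i : 'I_3) : {for v, continuous (fun w : V => w 0 i)}.
  exact: coord_continuous.
apply: (@continuousB _ _ _ (fun w : V => w 0 0 * w 0 0 + w 0 1 * w 0 1)
  (fun w : V => w 0 2 * w 0 2)); last by apply: continuousM; exact: co.
by apply: continuousD; apply: continuousM; exact: co.
Qed.

(** If w = s u + t v and u, v, w are null, then 2 s t [lorentz u v] = 0. The last factor is nonzero
    for distinct points, so w spans the same point as u or v. *)
Lemma light_cone_no3 (p : 3.-tuple {vspace V}) :
  uniq p -> (forall i, light_cone (tnth p i)) -> ~ collinear p.
Proof.
move=> pU pO [l l2 lp].
have pne (i j : 'I_3) : i != j -> tnth p i <> tnth p j.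
  by move=> ij /eqP; rewrite (inj_eq (tuple_uniqP _ pU)) (negbTE ij).
have dim1 i : \dim (tnth p i) = 1%N by case: (lp i).
(* Two distinct points span the line: a sum of dimension one would equal both of them. *)
have lE : (tnth p 0%R + tnth p 1%R)%VS = l.
  apply/eqP; rewrite eqEdim l2 subv_add (lp 0).2 (lp 1).2 /= ltnNge.
  apply/negP => d1.
  have sub0 : (tnth p 0%R == tnth p 0%R + tnth p 1%R)%VS.
    by rewrite eqEdim addvSl dim1.
  have sub1 : (tnth p 1%R == tnth p 0%R + tnth p 1%R)%VS.
    by rewrite eqEdim addvSr dim1.
  by apply: (pne 0 1) => //; rewrite (eqP sub0) -(eqP sub1).
have [u u0 [uE uu]] := pO 0; have [v v0 [vE vv]] := pO 1.
have [w w0 [wE ww]] := pO 2.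
have : w \in (<[u]> + <[v]>)%VS by rewrite -uE -vE lE memvE -wE (lp 2).2.
move=> /memv_addP[_ /vlineP[s ->] [_ /vlineP[t ->] wst]].
have uv : lorentz u v != 0.
  apply/eqP => uv; apply: (pne 0 1) => //; rewrite uE vE.
  exact: lorentz_null_orthogonal.
have /eqP : 2 * s * t * lorentz u v = 0.
  move: ww; rewrite wst !lorentzDr !lorentzZr ![lorentz (_ + _) _]lorentzC.
  rewrite !lorentzDr !lorentzZr uu vv (lorentzC v u) => h.
  by rewrite -[RHS]h; ring.
rewrite mulf_eq0 (negbTE uv) orbF -mulrA mulf_eq0 pnatr_eq0 /= mulf_eq0.
case/orP => /eqP st0; move: wst; rewrite st0 scale0r ?add0r ?addr0 => wE'.
  have t0 : t != 0 by apply: contraNneq w0 => t0; rewrite wE' t0 scale0r.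
  by apply: (pne 2 1) => //; rewrite wE vE wE' vlineZ.
have s0 : s != 0 by apply: contraNneq w0 => s0; rewrite wE' s0 scale0r.
by apply: (pne 2 0) => //; rewrite wE uE wE' vlineZ.
Qed.

(** The tangent at u is its Lorentz-orthogonal plane. Any other line through u meets the conic a
    second time. *)
Lemma light_cone_tangent p : light_cone p ->
  exists! l, rp2_lines l /\ light_cone `&` points_on l = [set p].
Proof.
move=> [u u0 [-> uu]].
(* The Euclidean normal of the tangent: flipping the last sign turns [dot] into [lorentz]. *)
pose a : V := \row_i (if i == 2 then - u 0 2 else u 0 i).
have dotE v : dot v a = lorentz u v by rewrite /dot /lorentz !mxE /=; ring.
have a0 : a != 0.
  apply: contraNneq u0 => a0; apply/eqP; apply: row3P; rewrite mxE.
  - by move/rowP/(_ 0): a0; rewrite !mxE.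
  - by move/rowP/(_ 1): a0; rewrite !mxE.
  - by move/rowP/(_ 2)/eqP: a0; rewrite !mxE /= oppr_eq0 => /eqP.
exists (perp a); split.
  split; first exact: perp_line.
  apply/seteqP; split=> [_ [[v v0 [-> vv]] /(points_on_perp _ v0)]|_ ->] /=.
    by rewrite dotE => uv; apply: esym; exact: lorentz_null_orthogonal.
  by split; [apply/light_coneP | apply/points_on_perp; rewrite ?dotE].
move=> l [l2 lO].
have [_ [_ ul]] : (light_cone `&` points_on l) <[u]>%VS by rewrite lO.
apply/esym/eqP; rewrite eqEdim l2 (perp_line a0) leqnn andbT.
apply/subvP => w wl; rewrite mem_perp dotE; apply/negPn/negP => uw.
(* Second intersection with the conic of the line through u and w. *)
pose v := (2 * lorentz u w) *: w - lorentz w w *: u.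
have uv : lorentz u v = 2 * lorentz u w ^+ 2.
  by rewrite /v -scaleNr lorentzDr !lorentzZr uu; ring.
have uv0 : lorentz u v != 0 by rewrite uv mulf_neq0 ?pnatr_eq0 ?expf_neq0.
have v0 : v != 0.
  apply: contraNneq uv0 => ->; rewrite -(scale0r u) lorentzZr; apply/eqP; ring.
have vv : lorentz v v = 0.
  rewrite {2}/v -scaleNr lorentzDr !lorentzZr ![lorentz v _]lorentzC uv.
  by rewrite /v -scaleNr lorentzDr !lorentzZr (lorentzC w u); ring.
have : (light_cone `&` points_on l) <[v]>%VS.
  split; first exact/light_coneP.
  split; first exact: rp2_vline.
  by rewrite -memvE memvB ?memvZ // memvE.
(* Tangency makes u a multiple of the null vector v, so [lorentz u v] would vanish. *)
rewrite lO /= => uvE; have [k _ uE] := vline_eqP v0 u0 uvE.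
by move: uv0; rewrite uE lorentzC lorentzZr vv mulr0 eqxx.
Qed.

Lemma light_cone_oval : oval light_cone.
Proof.
split; [exact: light_cone_rp2 | | exact: light_cone_closed
  | exact: light_cone_no3 | exact: light_cone_tangent].
exists <[eta1 R + eta3 R]>%VS; apply/light_coneP.
  by apply/eqP => /rowP/(_ 0)/eqP; rewrite !mxE /= addr0 oner_eq0.
by rewrite /lorentz !mxE /=; ring.
Qed.

End ConicOfEigenbases.

Theorem mainTheorem4 (R : realType) :
  [/\ exists2 O : set {vspace 'rV[R]_3},
        oval O & eigenbases_correspond (@a34 R) O,
      eigenbases_correspond (@a35 R) (@rp2 R)
    & forall b : R, exists l1 l2 : {vspace 'rV[R]_3},
        [/\ rp2_lines l1, rp2_lines l2, l1 <> l2
          & eigenbases_correspond (a38 b) (points_on l1 `|` points_on l2)] ].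
Proof.
split; [|exact: a35_correspond|move=> b].
  by exists (@light_cone R); [exact: light_cone_oval | exact: a34_correspond].
have [a1 a2 l12] := a38_lines_neq R.
exists (perp (eta2 R - eta3 R)), (perp (eta2 R + eta3 R)).
by split=> //; [exact: perp_line | exact: perp_line | exact: a38_correspond].
Qed.
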